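(* Let $\mathbb{F}$ be a field, let $\oslash$ be a Kronecker quotient over $\mathbb{F}$ and let $\ominus$ be the induced Kronecker difference $X\ominus B:=(X-I_m\otimes B)\oslash I_n$ for all $X\in\mathbb{F}_{mn}$, $B\in\mathbb{F}_n$, $m,n\in\mathbb{N}$. In each item below, the hypothesis and the conclusion are identities required for all matrices (and scalars $k\in\mathbb{F}$) for which the expressions are defined; in particular $A,C\in\mathbb{F}_{mn}$ and $B,D\in\mathbb{F}_n$. (a) If $(A\oslash B)^T=A^T\oslash B^T$, then $(A\ominus B)^T=A^T\ominus B^T$. (b) If $\operatorname{tr}(A\oslash B)=\dfrac{\operatorname{tr}(A)}{\operatorname{tr}(B)}$ (whenever $\operatorname{tr}(B)\neq0$), then $\operatorname{tr}(A\ominus B)=\dfrac1n(\operatorname{tr}(A)-m\operatorname{tr}(B))$ (whenever $n\ne 0$ in $\mathbb{F}$). (c) If $\oslash$ is uniform, then $\ominus$ is uniform. (d) If $(kA)\oslash B=k(A\oslash B)$, then $(kA)\ominus(kB)=k(A\ominus B)$. (e) If $(A+C)\oslash B=A\oslash B+C\oslash B$, then $(A+C)\ominus(B+D)=A\ominus B+C\ominus D$.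
   Context: $\mathbb{F}_m$ is the space of $m\times m$ matrices over $\mathbb{F}$, $\mathbb{N}$ is the set of positive integers, $\otimes$ is the Kronecker product, and $\mathbb{F}_m\otimes\mathbb{F}_n$ is identified with $\mathbb{F}_{mn}$. The Kronecker sum of $A\in\mathbb{F}_m$ and $B\in\mathbb{F}_n$ is $A\oplus B=A\otimes I_n+I_m\otimes B$. A Kronecker quotient is a family of operations $\oslash:\mathbb{F}_{mn}\times\mathbb{F}_n\to\mathbb{F}_m$, indexed by $m,n\in\mathbb{N}$, such that $(A\otimes B)\oslash B=A$ for all $A\in\mathbb{F}_m$ and all non-zero $B\in\mathbb{F}_n$, $m,n\in\mathbb{N}$. It is uniform if $(A\otimes C)\oslash B=A\otimes(C\oslash B)$ for all $A\in\mathbb{F}_m$, $B\in\mathbb{F}_n$, $C\in\mathbb{F}_p\otimes\mathbb{F}_n$, $m,n,p\in\mathbb{N}$, and $(A+B)\oslash C=(A\oslash C)+(B\oslash C)$, $(kA)\oslash C=k(A\oslash C)$ for all matrices $A,B,C$ and scalars $k\in\mathbb{F}$ whenever the operations are defined. A Kronecker difference is a family of operations $\ominus:\mathbb{F}_{mn}\times\mathbb{F}_n\to\mathbb{F}_m$, indexed by $m,n\in\mathbb{N}$, such that $(A\oplus B)\ominus B=A$ for all $A\in\mathbb{F}_m$, $B\in\mathbb{F}_n$, $m,n\in\mathbb{N}$. It is uniform if $(A\oplus C)\ominus B=A\oplus(C\ominus B)$ for all $A\in\mathbb{F}_m$, $B\in\mathbb{F}_n$, $C\in\mathbb{F}_p\otimes\mathbb{F}_n$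 and $m,n,p\in\mathbb{N}$, and moreover $(A+B)\ominus(C+D)=(A\ominus C)+(B\ominus D)$ and $(kA)\ominus(kC)=k(A\ominus C)$ for all matrices $A,B,C,D$ and scalars $k\in\mathbb{F}$ whenever the operations are defined. *)

(* Defs.v *)
From mathcomp Require Import all_boot all_algebra.
From mathcomp.real_closed Require Export mxtens.

Set Implicit Arguments.
Unset Strict Implicit.
Unset Printing Implicit Defensive.

Import GRing.Theory.
Local Open Scope ring_scope.

Reserved Notation "A ⊗ B" (at level 40, left associativity).
Reserved Notation "A ⊕ B" (at level 50, left associativity).
Reserved Notation "A ⊘[ q ] B" (at level 40, left associativity).
Reserved Notation "A ⊖[ d ] B" (at level 50, left associativity).

Notation "A ⊗ B" := (tensmx A B) : ring_scope.

Definition kronecker_sum (F : fieldType) (m n : nat)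
    (A : 'M[F]_m) (B : 'M[F]_n) : 'M[F]_(m * n) :=
  A ⊗ 1%:M + 1%:M ⊗ B.

Notation "A ⊕ B" := (kronecker_sum A B) : ring_scope.

(* Identifies F_m (x) (F_p (x) F_n) with (F_m (x) F_p) (x) F_n; with the
   row-major indexing of tensmx this leaves the entries in place. *)
Definition mxassoc (F : fieldType) (m p n : nat)
    (A : 'M[F]_(m * (p * n))) : 'M[F]_(m * p * n) :=
  castmx (mulnA m p n, mulnA m p n) A.

(* Matrix dimensions range over the positive integers: the operations below
   are total in m and n, but nothing is required of them, nor of any property
   of them, when a dimension is 0. *)

Record kronecker_quotient (F : fieldType) := KroneckerQuotient {
  kquot : forall m n : nat, 'M[F]_(m * n) -> 'M[F]_n -> 'M[F]_m;
  kquotK : forall m n : nat, (0 < m)%N -> (0 < n)%N ->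
    forall (A : 'M[F]_m) (B : 'M[F]_n), B != 0 -> kquot (A ⊗ B) B = A
}.

Notation "A ⊘[ q ] B" := (kquot q A B) : ring_scope.

Record kronecker_difference (F : fieldType) := KroneckerDifference {
  kdiff : forall m n : nat, 'M[F]_(m * n) -> 'M[F]_n -> 'M[F]_m;
  kdiffK : forall m n : nat, (0 < m)%N -> (0 < n)%N ->
    forall (A : 'M[F]_m) (B : 'M[F]_n), kdiff (A ⊕ B) B = A
}.

Notation "A ⊖[ d ] B" := (kdiff d A B) : ring_scope.

Definition uniform_quotient (F : fieldType) (q : kronecker_quotient F) : Prop :=
  [/\ forall m n p : nat, (0 < m)%N -> (0 < n)%N -> (0 < p)%N ->
        forall (A : 'M[F]_m) (B : 'M[F]_n) (C : 'M[F]_(p * n)),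
        mxassoc (A ⊗ C) ⊘[q] B = A ⊗ (C ⊘[q] B),
      forall m n : nat, (0 < m)%N -> (0 < n)%N ->
        forall (A B : 'M[F]_(m * n)) (C : 'M[F]_n),
        (A + B) ⊘[q] C = (A ⊘[q] C) + (B ⊘[q] C)
    & forall m n : nat, (0 < m)%N -> (0 < n)%N ->
        forall (k : F) (A : 'M[F]_(m * n)) (C : 'M[F]_n),
        (k *: A) ⊘[q] C = k *: (A ⊘[q] C)].

Definition uniform_difference (F : fieldType) (d : kronecker_difference F) :
    Prop :=
  [/\ forall m n p : nat, (0 < m)%N -> (0 < n)%N -> (0 < p)%N ->
        forall (A : 'M[F]_m) (B : 'M[F]_n) (C : 'M[F]_(p * n)),
        mxassoc (A ⊕ C) ⊖[d] B = A ⊕ (C ⊖[d] B),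
      forall m n : nat, (0 < m)%N -> (0 < n)%N ->
        forall (A B : 'M[F]_(m * n)) (C D : 'M[F]_n),
        (A + B) ⊖[d] (C + D) = (A ⊖[d] C) + (B ⊖[d] D)
    & forall m n : nat, (0 < m)%N -> (0 < n)%N ->
        forall (k : F) (A : 'M[F]_(m * n)) (C : 'M[F]_n),
        (k *: A) ⊖[d] (k *: C) = k *: (A ⊖[d] C)].

Definition induced_op (F : fieldType) (q : kronecker_quotient F) (m n : nat)
    (X : 'M[F]_(m * n)) (B : 'M[F]_n) : 'M[F]_m :=
  (X - 1%:M ⊗ B) ⊘[q] 1%:M.

Lemma induced_opK (F : fieldType) (q : kronecker_quotient F) (m n : nat) :
  (0 < m)%N -> (0 < n)%N ->
  forall (A : 'M[F]_m) (B : 'M[F]_n), induced_op q (A ⊕ B) B = A.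
Proof.
move=> m_gt0 n_gt0 A B; rewrite /induced_op /kronecker_sum addrK kquotK //.
by case: n n_gt0 {B} => // n _; apply: oner_neq0.
Qed.

Definition induced_difference (F : fieldType) (q : kronecker_quotient F) :
    kronecker_difference F :=
  KroneckerDifference (@induced_opK F q).

(* Main.v *)
(* Each property passes from the quotient by I_n to the difference because
   B |-> I_m (x) B is linear and commutes with transposition, and has trace
   m tr B.  For uniformity, (A (+) C) - I_{mp} (x) B equals
   A (x) I_{pn} + I_m (x) (C - I_p (x) B), and I_{pn} (/) I_n = I_p since
   I_{pn} = I_p (x) I_n. *)
Require Import Defs.
From mathcomp Require Import all_boot all_algebra.

Set Implicit Arguments.
Unset Strict Implicit.
Unset Printing Implicit Defensive.

Import GRing.Theory.
Local Open Scope ring_scope.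

Section TensorProduct.

Variable R : pzRingType.

Lemma tensmxDr m n p r (A : 'M[R]_(m, n)) (B C : 'M[R]_(p, r)) :
  A ⊗ (B + C) = A ⊗ B + A ⊗ C.
Proof. by apply/matrixP=> i j; rewrite !mxE mulrDr. Qed.

Lemma tensmxBr m n p r (A : 'M[R]_(m, n)) (B C : 'M[R]_(p, r)) :
  A ⊗ (B - C) = A ⊗ B - A ⊗ C.
Proof. by apply/matrixP=> i j; rewrite !mxE mulrBr. Qed.

Lemma tens_mx1 m n : 1%:M ⊗ 1%:M = 1%:M :> 'M[R]_(m * n).
Proof.
apply/matrixP=> i j.
case: (mxtens_indexP i) => i0 i1; case: (mxtens_indexP j) => j0 j1.
(* Flattening pairs is injective, so the Kronecker delta of two flattened indices is the product of
   the deltas of their components. *)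
rewrite tensmxE !mxE (can_eq (@mxtens_indexK m n)) xpair_eqE.
by rewrite -natrM mulnb.
Qed.

(** A diagonal position of the product decodes to a pair of diagonal positions, so the sum is a
    product of two sums. *)
Lemma mxtrace_tens m n (A : 'M[R]_m) (B : 'M[R]_n) :
  \tr (A ⊗ B) = \tr A * \tr B.
Proof. by rewrite /mxtrace mulr_sum; apply: eq_bigr => i _; rewrite mxE. Qed.

End TensorProduct.

(** Commutativity lets [k] move past the entries of [A]. *)
Lemma tensmxZr (R : comPzRingType) m n p r (k : R) (A : 'M[R]_(m, n))
    (B : 'M[R]_(p, r)) :
  A ⊗ (k *: B) = k *: (A ⊗ B).
Proof. by apply/matrixP=> i j; rewrite !mxE mulrCA. Qed.

Section Assoc.

Variables (F : fieldType) (m p n : nat).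

Lemma mxassocD (A B : 'M[F]_(m * (p * n))) :
  mxassoc (A + B) = mxassoc A + mxassoc B.
Proof. by apply/matrixP=> i j; rewrite !(mxE, castmxE). Qed.

Lemma mxassocB (A B : 'M[F]_(m * (p * n))) :
  mxassoc (A - B) = mxassoc A - mxassoc B.
Proof. by apply/matrixP=> i j; rewrite !(mxE, castmxE). Qed.

Lemma mxassoc_tens (A : 'M[F]_m) (B : 'M[F]_p) (C : 'M[F]_n) :
  mxassoc (A ⊗ (B ⊗ C)) = A ⊗ B ⊗ C.
Proof.
(* Both bracketings flatten (a, b, c) to the same number: (a p + b) n + c = a (p n) + (b n + c). *)
have assocE a b c : cast_ord (esym (mulnA m p n))
    (mxtens_index (mxtens_index (a, b), c)) =
    mxtens_index (a, mxtens_index (b, c)).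
  by apply: val_inj; rewrite /= mulnDl mulnA addnA.
apply/matrixP=> i j; rewrite castmxE.
case: (mxtens_indexP i) => i0 i1; case: (mxtens_indexP i0) => i2 i3.
case: (mxtens_indexP j) => j0 j1; case: (mxtens_indexP j0) => j2 j3.
by rewrite !assocE !tensmxE mulrA.
Qed.

End Assoc.

Section InducedDifference.

Variables (F : fieldType) (q : kronecker_quotient F).

Let d := induced_difference q.

Lemma kquot11 m n : (0 < m)%N -> (0 < n)%N ->
  (1%:M : 'M[F]_(m * n)) ⊘[q] 1%:M = 1%:M.
Proof.
move=> m_gt0 n_gt0; rewrite -tens_mx1 kquotK //.
(* The divisor I_n is non-zero because n is positive. *)
by case: n n_gt0 => // n _; apply: oner_neq0.
Qed.

Section Size.

Variables m n : nat.

Lemma induced_diffT :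
    (forall (A : 'M[F]_(m * n)) (B : 'M[F]_n),
      (A ⊘[q] B)^T = A^T ⊘[q] B^T) ->
  forall (A : 'M[F]_(m * n)) (B : 'M[F]_n), (A ⊖[d] B)^T = A^T ⊖[d] B^T.
Proof.
move=> qT A B; rewrite /= /induced_op qT.
by rewrite linearB /= trmx_tens !trmx1.
Qed.

(** The only divisor involved is I_n, of trace n, so the condition on \tr B in the hypothesis
    becomes that n is non-zero in F. *)
Lemma induced_diff_tr : n%:R != 0 :> F ->
    (forall (A : 'M[F]_(m * n)) (B : 'M[F]_n), \tr B != 0 ->
      \tr (A ⊘[q] B) = \tr A / \tr B) ->
  forall (A : 'M[F]_(m * n)) (B : 'M[F]_n),
    \tr (A ⊖[d] B) = n%:R^-1 * (\tr A - m%:R * \tr B).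
Proof.
move=> n_neq0 qtr A B; rewrite /= /induced_op qtr mxtrace1 //.
by rewrite linearB /= mxtrace_tens mxtrace1 mulrC.
Qed.

Lemma induced_diffZ :
    (forall (k : F) (A : 'M[F]_(m * n)) (B : 'M[F]_n),
      (k *: A) ⊘[q] B = k *: (A ⊘[q] B)) ->
  forall (k : F) (A : 'M[F]_(m * n)) (B : 'M[F]_n),
    (k *: A) ⊖[d] (k *: B) = k *: (A ⊖[d] B).
Proof.
by move=> qZ k A B; rewrite /= /induced_op tensmxZr -scalerBr qZ.
Qed.

Lemma induced_diffD :
    (forall (A C : 'M[F]_(m * n)) (B : 'M[F]_n),
      (A + C) ⊘[q] B = (A ⊘[q] B) + (C ⊘[q] B)) ->
  forall (A C : 'M[F]_(m * n)) (B D : 'M[F]_n),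
    (A + C) ⊖[d] (B + D) = (A ⊖[d] B) + (C ⊖[d] D).
Proof.
(* Regrouping pairs [A] with the shift by [B] and [C] with the shift by [D]; the divisor I_n is the
   same for both. *)
by move=> qD A C B D; rewrite /= /induced_op tensmxDr opprD addrACA; apply: qD.
Qed.

End Size.

Lemma induced_diff_uniform : uniform_quotient q -> uniform_difference d.
Proof.
case=> q_tens qD qZ; split=> [m n p m_gt0 n_gt0 p_gt0 A B C|m n m_gt0 n_gt0|].
- rewrite /= /induced_op; have -> : mxassoc (A ⊕ C) - 1%:M ⊗ B
      = mxassoc (A ⊗ 1%:M) + mxassoc (1%:M ⊗ (C - 1%:M ⊗ B)).
    (* Expanding the right side yields the term I_m ⊗ (I_p ⊗ B), which reassociates to I_{mp} ⊗
       B. *)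
    by rewrite tensmxBr mxassocB mxassocD mxassoc_tens tens_mx1 addrA.
  (* Additivity is used at size (m p, n); pulling out the left factors then leaves quotients at size
     (p, n). *)
  by rewrite qD ?muln_gt0 ?m_gt0 // !q_tens // kquot11.
- by apply: induced_diffD; apply: qD.
- by move=> m n m_gt0 n_gt0; apply: induced_diffZ; apply: qZ.
Qed.

End InducedDifference.

Theorem proposition2 (F : fieldType) (q : kronecker_quotient F) :
  let d := induced_difference q in
  [/\ (* (a) *)
      (forall m n : nat, (0 < m)%N -> (0 < n)%N ->
         forall (A : 'M[F]_(m * n)) (B : 'M[F]_n),
         (A ⊘[q] B)^T = A^T ⊘[q] B^T) ->
      (forall m n : nat, (0 < m)%N -> (0 < n)%N ->
         forall (A : 'M[F]_(m * n)) (B : 'M[F]_n),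
         (A ⊖[d] B)^T = A^T ⊖[d] B^T),
      (* (b) *)
      (forall m n : nat, (0 < m)%N -> (0 < n)%N ->
         forall (A : 'M[F]_(m * n)) (B : 'M[F]_n), \tr B != 0 ->
         \tr (A ⊘[q] B) = \tr A / \tr B) ->
      (forall m n : nat, (0 < m)%N -> (0 < n)%N -> n%:R != 0 :> F ->
         forall (A : 'M[F]_(m * n)) (B : 'M[F]_n),
         \tr (A ⊖[d] B) = n%:R^-1 * (\tr A - m%:R * \tr B)),
      (* (c) *)
      uniform_quotient q -> uniform_difference d,
      (* (d) *)
      (forall m n : nat, (0 < m)%N -> (0 < n)%N ->
         forall (k : F) (A : 'M[F]_(m * n)) (B : 'M[F]_n),
         (k *: A) ⊘[q] B = k *: (A ⊘[q] B)) ->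
      (forall m n : nat, (0 < m)%N -> (0 < n)%N ->
         forall (k : F) (A : 'M[F]_(m * n)) (B : 'M[F]_n),
         (k *: A) ⊖[d] (k *: B) = k *: (A ⊖[d] B))
    & (* (e) *)
      (forall m n : nat, (0 < m)%N -> (0 < n)%N ->
         forall (A C : 'M[F]_(m * n)) (B : 'M[F]_n),
         (A + C) ⊘[q] B = (A ⊘[q] B) + (C ⊘[q] B)) ->
      (forall m n : nat, (0 < m)%N -> (0 < n)%N ->
         forall (A C : 'M[F]_(m * n)) (B D : 'M[F]_n),
         (A + C) ⊖[d] (B + D) = (A ⊖[d] B) + (C ⊖[d] D))].
Proof.
(* Items (d) and (e) are treated first. All items but (c) transfer one size (m, n) at a time. *)
split=> [qT|qtr||qZ|qD]; last 2 first.
- by move=> m n m_gt0 n_gt0; apply: induced_diffZ; apply: qZ.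
- by move=> m n m_gt0 n_gt0; apply: induced_diffD; apply: qD.
- by move=> m n m_gt0 n_gt0; apply: induced_diffT; apply: qT.
- by move=> m n m_gt0 n_gt0 n_neq0; apply: induced_diff_tr => //; apply: qtr.
exact: induced_diff_uniform.
Qed.
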